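(* Let $n\geq 3$ and let $\mathcal{F}\subseteq 2^{[n]}$ be a family of subsets of $[n]=\{1,\ldots,n\}$ containing no four distinct members $A,B,C,D\in\mathcal{F}$ with $A\cup B\subseteq C\cap D$, and suppose $\emptyset\notin\mathcal{F}$ and $[n]\notin\mathcal{F}$. Then $$\sum_{F\in\mathcal{F}}\binom{n}{|F|}^{-1}\leq 2.$$ *)

(* Defs.v *)
From mathcomp Require Import all_boot all_order all_algebra.

Set Implicit Arguments.
Unset Strict Implicit.
Unset Printing Implicit Defensive.

(* The ground set [n] = {1, ..., n} is encoded as 'I_n = {0, ..., n-1}. *)
Definition butterfly_free (n : nat) (FF : {set {set 'I_n}}) : Prop :=
  ~ exists A B C D : {set 'I_n},
      [/\ A \in FF, B \in FF, C \in FF & D \in FF] /\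
      uniq [:: A; B; C; D] /\
      A :|: B \subset C :&: D.

(* Main.v *)
Require Import Defs.
From mathcomp Require Import all_boot all_order all_algebra.
From mathcomp Require Import all_fingroup all_solvable.

(** A permutation [s] of [n] encodes the maximal chain of its initial segments,
and a [k]-set lies on the fraction [1 / 'C(n, k)] of all maximal chains, so the
claim is that a maximal chain meets the family in at most 2 members on average.
The number of members met exceeds 2 by at most the number of middle ones, i.e.
those [B] with a member [A] below and a member [C] above on the chain.
Butterfly-freeness makes [A] and [C] the only members comparable to such a [B];
swapping a point of [A] with one of [B :\: A], and a point of [C :\: B] with one
outside [C], turns the chains with middle [B] injectively into chains that meet
the family in [B] only. These are compensated, as they fall short of 2 by 1. *)

Set Implicit Arguments.
Unset Strict Implicit.
Unset Printing Implicit Defensive.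

Import Order.TTheory GRing.Theory Num.Theory.
Local Open Scope ring_scope.

(** A maximal chain has exactly one set of each size, so only the image of the first [#|A|] points
    has to be compared with [A]. *)
Definition on_chain (n : nat) (s : 'S_n) (A : {set 'I_n}) : bool :=
  s @: [set i : 'I_n | (i < #|A|)%N] == A.

Lemma card_init_seg (n k : nat) :
  (k <= n)%N -> #|[set i : 'I_n | (i < k)%N]| = k.
Proof.
move=> lekn.
have -> : [set i : 'I_n | (i < k)%N] = widen_ord lekn @: [set: 'I_k].
  apply/setP => i; rewrite inE; apply/idP/imsetP => [ltik | [j _ ->]].
    by exists (Ordinal ltik) => //; apply: val_inj.
  exact: (ltn_ord j).
rewrite card_imset ?cardsT ?card_ord // => i j /(congr1 val) /= eqij.
exact: val_inj.
Qed.

Lemma on_chain_subset (n : nat) (s : 'S_n) (A B : {set 'I_n}) :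
  on_chain s A -> on_chain s B -> (#|A| <= #|B|)%N -> A \subset B.
Proof.
move=> /eqP sA /eqP sB leAB; rewrite -sA -sB; apply: imsetS.
by apply/subsetP => i; rewrite !inE => /leq_trans; apply.
Qed.

Lemma on_chain_inj (n : nat) (s : 'S_n) (A B : {set 'I_n}) :
  on_chain s A -> on_chain s B -> #|A| = #|B| -> A = B.
Proof. by move=> /eqP sA /eqP sB eqAB; rewrite -sA -sB eqAB. Qed.

Lemma on_chainM (n : nat) (s t : 'S_n) (A : {set 'I_n}) :
  on_chain s A -> on_chain (s * t)%g (t @: A).
Proof.
move=> /eqP sA; rewrite /on_chain card_imset; last exact: perm_inj.
rewrite -{2}sA -imset_comp; apply/eqP/eq_imset => i /=; exact: permM.
Qed.

(** List each set first and its complement after it: this gives two tuples of all points without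
    repetition, and the symmetric group is transitive on such tuples. *)
Lemma perm_imset_exists (T : finType) (A B : {set T}) :
  #|A| = #|B| -> exists t : {perm T}, t @: A = B.
Proof.
move=> eqAB.
pose e (X : {set T}) := enum X ++ enum (~: X).
have size_e X : size (e X) == #|T| by rewrite size_cat -!cardE cardsC.
have e_dtuple X : Tuple (size_e X) \in #|T|.-dtuple(setT).
  rewrite inE /= cat_uniq !enum_uniq andbT.
  apply/andP; split; last by apply/subsetP => x; rewrite inE.
  apply/hasPn => x; rewrite !mem_enum inE => /negP xNX; exact/negP.
have [t _ teB] := atransP2 (Sym_trans T) (e_dtuple A) (e_dtuple B).
exists t; move/(congr1 val): teB => /= /eqP.
(* By [#|A| = #|B|] both lists split at the same position, so [t] maps the first block onto the
   first block. *)
rewrite /e map_cat eqseq_cat ?size_map -?cardE // => /andP[/eqP eB _].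
apply/setP => x; rewrite -[RHS]mem_enum eB.
apply/imsetP/mapP => -[y yA ->]; exists y => //;
  by rewrite ?mem_enum // -mem_enum.
Qed.

Lemma leq_card_on_chain (n : nat) (A B : {set 'I_n}) :
  #|A| = #|B| ->
  (#|[set s | on_chain s A]| <= #|[set s | on_chain s B]|)%N.
Proof.
move=> /perm_imset_exists[t <-].
rewrite -(card_imset _ (@mulIg _ t)); apply/subset_leq_card/subsetP.
by move=> _ /imsetP[s sA ->]; move: sA; rewrite !inE; apply: on_chainM.
Qed.

Lemma card_on_chain (n : nat) (A : {set 'I_n}) :
  (#|[set s | on_chain s A]| * 'C(n, #|A|) = n`!)%N.
Proof.
pose K := [set i : 'I_n | (i < #|A|)%N].
have cardK : #|K| = #|A|.
  by apply: card_init_seg; rewrite -[n in (_ <= n)%N]card_ord max_card.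
have -> : n`! = #|[set: 'S_n]|.
  by rewrite cardsT card_Sn.
rewrite -[RHS]sum1_card.
rewrite (partition_big (fun s : 'S_n => s @: K)
          [in [set B : {set 'I_n} | #|B| == #|A|]]) /=; last first.
  by move=> s _; rewrite inE card_imset ?cardK //; apply: perm_inj.
rewrite (eq_bigr (fun=> #|[set s | on_chain s A]|)); last first.
  move=> B; rewrite inE => /eqP cBA; rewrite sum1dep_card.
  transitivity #|[set s | on_chain s B]|.
    by apply: eq_card => s; rewrite !inE /on_chain cBA.
  by apply/eqP; rewrite eqn_leq !leq_card_on_chain.
by rewrite sum_nat_const card_draws card_ord mulnC.
Qed.

Definition chain_trace (n : nat) (FF : {set {set 'I_n}}) (s : 'S_n) :=
  [set F in FF | on_chain s F].

Definition middle (n : nat) (FF : {set {set 'I_n}}) (s : 'S_n)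
    (B : {set 'I_n}) : bool :=
  [&& B \in chain_trace FF s,
      [exists A in chain_trace FF s, A \proper B] &
      [exists C in chain_trace FF s, B \proper C]].

Lemma on_chain_proper (n : nat) (s : 'S_n) (A B : {set 'I_n}) :
  on_chain s A -> on_chain s B -> A != B -> (#|A| <= #|B|)%N -> A \proper B.
Proof.
by move=> sA sB neqAB leAB; rewrite properEneq neqAB (on_chain_subset sA sB).
Qed.

(** Apart from the smallest and the largest member on the chain, all members on it are middle. *)
Lemma card_chain_trace (n : nat) (FF : {set {set 'I_n}}) (s : 'S_n) :
  (#|chain_trace FF s| <= 2 + #|[set B | middle FF s B]|)%N.
Proof.
case: (set_0Vmem (chain_trace FF s)) => [-> | [F0 F0s]]; first by rewrite cards0.
case: (arg_minnP (fun F : {set 'I_n} => #|F|) F0s) => A As minA.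
case: (arg_maxnP (fun F : {set 'I_n} => #|F|) F0s) => C Cs maxC.
have sub : chain_trace FF s \subset [set A; C] :|: [set B | middle FF s B].
  apply/subsetP => B Bs; rewrite !inE.
  case: (eqVneq B A) => //= neBA; case: (eqVneq B C) => //= neBC.
  rewrite /middle Bs /=.
  have on F : F \in chain_trace FF s -> on_chain s F by rewrite inE => /andP[].
  apply/andP; split; apply/exists_inP; [exists A | exists C] => //.
    by apply: on_chain_proper (on A As) (on B Bs) _ (minA B Bs); rewrite eq_sym.
  exact: on_chain_proper (on B Bs) (on C Cs) neBC (maxC B Bs).
apply: leq_trans (subset_leq_card sub) _; apply: leq_trans (leq_card_setU _ _) _.
by rewrite leq_add2r cards2; case: eqP.
Qed.

Lemma imset_tperm_id (T : finType) (x y : T) (A : {set T}) :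
  (x \in A) = (y \in A) -> tperm x y @: A = A.
Proof.
move=> xyA; apply/eqP; rewrite eqEcard card_imset ?leqnn ?andbT;
  last exact: perm_inj.
apply/subsetP => _ /imsetP[z + ->].
by case: tpermP => [-> | -> |]; rewrite ?xyA.
Qed.

Lemma imset_tperm_neq (T : finType) (x y : T) (A : {set T}) :
  x \in A -> y \notin A -> tperm x y @: A != A.
Proof.
move=> xA; apply: contraNneq => <-.
by apply/imsetP; exists x => //; rewrite tpermL.
Qed.

Lemma imset_permM (T : finType) (s t : {perm T}) (A : {set T}) :
  (s * t)%g @: A = t @: (s @: A).
Proof. by rewrite -imset_comp; apply: eq_imset => x; rewrite /= permM. Qed.

Lemma uniq_proper_chain (T : finType) (A B C : {set T}) :
  A \proper B -> B \proper C -> [/\ A != B, B != C & A != C].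
Proof.
move=> AB BC; have AC := proper_trans AB BC.
by move: AB BC AC; rewrite !properEneq => /andP[-> _] /andP[-> _] /andP[-> _].
Qed.

Section ButterflyFree.

Variables (n : nat) (FF : {set {set 'I_n}}).
Hypothesis free : butterfly_free FF.

Section UniqueNeighbours.

Variables A B C : {set 'I_n}.
Hypotheses (AF : A \in FF) (BF : B \in FF) (CF : C \in FF).
Hypotheses (AB : A \proper B) (BC : B \proper C).

(** Otherwise [A'] and [A] both lie inside [B :&: C], which is [B] itself: a butterfly. *)
Lemma unique_below (A' : {set 'I_n}) : A' \in FF -> A' \proper B -> A' = A.
Proof.
move=> A'F A'B; apply/eqP; apply: contraT => neA; case: free.
have [nAB nBC nAC] := uniq_proper_chain AB BC.
have [nA'B _ nA'C] := uniq_proper_chain A'B BC.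
exists A', A, B, C; split => //; split.
  by rewrite /= !inE !negb_or neA nA'B nA'C nAB nAC nBC.
by rewrite subUset !subsetI !proper_sub ?(proper_trans _ BC).
Qed.

(** Dually, [A :|: B] is [B], which would lie inside both [C'] and [C]. *)
Lemma unique_above (C' : {set 'I_n}) : C' \in FF -> B \proper C' -> C' = C.
Proof.
move=> C'F BC'; apply/eqP; apply: contraT => neC; case: free.
have [nAB nBC nAC] := uniq_proper_chain AB BC.
have [_ nBC' nAC'] := uniq_proper_chain AB BC'.
exists A, B, C', C; split => //; split.
  by rewrite /= !inE !negb_or nAB nAC' nAC nBC nBC' neC.
by rewrite subUset !subsetI !proper_sub ?(proper_trans AB).
Qed.

End UniqueNeighbours.

Hypotheses (h0 : set0 \notin FF) (hT : [set: 'I_n] \notin FF).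

Lemma leq_card_middle (B : {set 'I_n}) :
  (#|[set s | middle FF s B]| <= #|[set s | chain_trace FF s == [set B]]|)%N.
Proof.
(* A single chain with middle [B] determines [A] and [C] for all of them, so one permutation [t]
   serves every chain. *)
case: (set_0Vmem [set s | middle FF s B]) => [-> | [s0]]; first by rewrite cards0.
rewrite inE => /and3P[]; rewrite inE => /andP[BF _].
move=> /exists_inP[A] /[!inE] /andP[AF _] AB.
move=> /exists_inP[C] /[!inE] /andP[CF _] BC.
have belowA := unique_below AF BF CF AB BC.
have aboveC := unique_above AF BF CF AB BC.
have [x xA] : exists x, x \in A.
  by apply/set0Pn; apply: contraNneq h0 => <-.
have [v vNC] : exists v, v \notin C.
  have : C \proper setT by rewrite properT; apply: contraNneq hT => <-.
  by case/properP => _ [v _ vNC]; exists v.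
have [/subsetP sAB [y yB yNA]] := properP AB.
have [/subsetP sBC [u uC uNB]] := properP BC.
have vNB : v \notin B by apply: contra vNC; apply: sBC.
(* The points [x], [y] are in [B] and [u], [v] are not, so the swaps are disjoint and preserve [B].
   The first moves [A] and preserves [C]; the second moves [C]. *)
pose t := (tperm x y * tperm u v)%g.
have tB : t @: B = B.
  by rewrite imset_permM !imset_tperm_id ?(negPf uNB) ?(negPf vNB) ?yB ?sAB.
have tA : t @: A != A.
  apply: contraNneq yNA => <-; apply/imsetP; exists x => //.
  by rewrite permM tpermL tpermD //;
    [apply: contraNneq uNB | apply: contraNneq vNB] => ->.
have tC : t @: C != C.
  rewrite imset_permM (@imset_tperm_id _ x y) ?imset_tperm_neq //.
  by rewrite (sBC _ yB) (sBC _ (sAB _ xA)).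
rewrite -(card_imset _ (@mulIg _ t)); apply/subset_leq_card/subsetP.
move=> _ /imsetP[s + ->]; rewrite !inE => /and3P[]; rewrite !inE => /andP[_ sB].
move=> /exists_inP[A'] /[!inE] /andP[A'F sA] /(belowA _ A'F) eA.
move=> /exists_inP[C'] /[!inE] /andP[C'F sC] /(aboveC _ C'F) eC.
subst A' C'.
have stB : on_chain (s * t)%g B by rewrite -tB on_chainM.
(* The new chain has [t @: D] as its only set of size [#|D|]. *)
have off (D : {set 'I_n}) : on_chain s D -> t @: D != D -> ~~ on_chain (s * t)%g D.
  move=> sD; apply: contra => stD; apply/eqP.
  apply: on_chain_inj (on_chainM t sD) stD _; apply: card_imset; exact: perm_inj.
apply/eqP/setP => F; rewrite !inE; apply/andP/eqP => [[FF_F stF] | -> //].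
apply/eqP; apply: contraT => neFB.
(* Sets on one chain are comparable, so a second member [F] would be [A] or [C], both of which have
   left the chain. *)
case: (leqP #|F| #|B|) => [leFB | /ltnW leBF].
  have /(belowA _ FF_F) eFA := on_chain_proper stF stB neFB leFB.
  by move: (off A sA tA); rewrite -eFA stF.
have /(aboveC _ FF_F) eFC : B \proper F.
  by apply: on_chain_proper stB stF _ leBF; rewrite eq_sym.
by move: (off C sC tC); rewrite -eFC stF.
Qed.

Lemma sum_chain_trace : (\sum_(s : 'S_n) #|chain_trace FF s| <= 2 * n`!)%N.
Proof.
pose sole s B := chain_trace FF s == [set B].
(* The sum on the left is 1 if the chain meets the family exactly once, and 0 otherwise; in the
   first case the left side is just 2. *)
have pointwise s : (#|chain_trace FF s| + \sum_(B | sole s B) 1 <=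
                    2 + \sum_(B | middle FF s B) 1)%N.
  case: (pickP (sole s)) => [B /eqP sB | no_sole].
    rewrite /sole sB cards1 (big_pred1 B) ?leq_addr //.
    by move=> B'; rewrite /= (inj_eq set1_inj) eq_sym.
  rewrite (eq_bigl _ _ no_sole) big_pred0_eq addn0 sum1dep_card.
  exact: card_chain_trace.
have swap P : (\sum_(s : 'S_n) \sum_(B | P s B) 1 =
               \sum_(B : {set 'I_n}) #|[set s | P s B]|)%N.
  rewrite (exchange_big_dep predT) //=.
  by apply: eq_bigr => B _; rewrite sum1dep_card.
have : (\sum_(s : 'S_n) (#|chain_trace FF s| + \sum_(B | sole s B) 1) <=
        \sum_(s : 'S_n) (2 + \sum_(B | middle FF s B) 1))%N.
  by apply: leq_sum => s _; apply: pointwise.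
rewrite !big_split /= !swap sum_nat_const card_Sn mulnC => le1.
rewrite -(leq_add2r (\sum_(B : {set 'I_n}) #|[set s | sole s B]|)).
apply: leq_trans le1 _; rewrite leq_add2l.
by apply: leq_sum => B _; apply: leq_card_middle.
Qed.

End ButterflyFree.

Theorem theorem2 (n : nat) (FF : {set {set 'I_n}})
  (hn : (3 <= n)%N)
  (hfree : butterfly_free FF)
  (h0 : set0 \notin FF)
  (hT : [set: 'I_n] \notin FF) :
  \sum_(F in FF) ('C(n, #|F|)%:R : rat)^-1 <= 2.
Proof.
have fact_neq0 : (n`!%:R : rat) != 0 by rewrite pnatr_eq0 -lt0n fact_gt0.
have weight (F : {set 'I_n}) :
    ('C(n, #|F|)%:R : rat)^-1 = #|[set s | on_chain s F]|%:R / n`!%:R.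
  have /(congr1 (fun k => k%:R : rat)) := card_on_chain F.
  rewrite natrM => eqF; move: fact_neq0; rewrite -eqF mulf_eq0 negb_or.
  by move=> /andP[N0 C0]; rewrite invfM mulrA divff ?mul1r.
rewrite (eq_bigr _ (fun F _ => weight F)) -mulr_suml -natr_sum.
rewrite ler_pdivrMr ?ltr0n ?fact_gt0 // -natrM ler_nat.
apply: leq_trans (sum_chain_trace hfree h0 hT).
(* Incidences between members and chains are now counted chain by chain. *)
rewrite (eq_bigr (fun F => \sum_(s : 'S_n | on_chain s F) 1)%N); last first.
  by move=> F _; rewrite sum1dep_card.
rewrite (exchange_big_dep predT) //=; apply: leq_sum => s _.
by rewrite sum1dep_card.
Qed.
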